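(* Let $G\in\mathcal{F}_2$ and let $(G,w)$ be an $8$-unbalanced pair. Assume $G$ admits no star cutset. Let $K_1,K_2,K_1',K_2'$ be cliques of $G$ such that $S(K_1,K_2)$ and $S(K_1',K_2')$ are active. Then $S(K_1,K_2)$ and $S(K_1',K_2')$ are loosely non-crossing, i.e. $A(K_1,K_2)\cap(K_1'\cup K_2')=\emptyset$ and $A(K_1',K_2')\cap(K_1\cup K_2)=\emptyset$.
   Context: A hole is an induced cycle of length at least four. $G$ is sparse if for every hole $H$ and vertex $v\notin V(H)$ there is an edge $ab$ of $H$ with $N(v)\cap V(H)\subseteq\{a,b\}$. Pyramids and prisms: a pyramid consists of a vertex $a$, a triangle $\{b_1,b_2,b_3\}$ and paths $P_i$ from $a$ to $b_i$ of length $\ge1$ with $P_i\setminus\{a\}$ pairwise disjoint, the only edge between $P_i\setminus\{a\}$ and $P_j\setminus\{a\}$ ($i\ne j$) being $b_ib_j$, and at most one $P_i$ of length one; a prism consists of disjoint triangles $\{a_1,a_2,a_3\},\{b_1,b_2,b_3\}$ and pairwise disjoint paths $P_i$ from $a_i$ to $b_i$ of length $\ge1$ with the only edges between $P_i,P_j$ ($i\ne j$) being $a_ia_j,b_ib_j$. $\mathcal{F}_2$ is the class of triangle-free sparse graphs with no induced pyramid or prism (so all cliques have size at most 2). A separation is a partition $(A,C,B)$ of $V(G)$ with no edges between $A$ and $B$; star separation if some $v\in C$ has $C\subseteq N[v]$; proper if $A,B\neq\emptyset$; $G$ admits a star cutset if it has a proper star separation. A weight function is $w:V(G)\to[0,1]$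 summing to $1$; $(G,w)$ is $d$-unbalanced if no set $X$ with $|X|\le d$ has every component $D$ of $G\setminus X$ of weight $\le\frac12$. For cliques $K_1,K_2$: $B(K_1,K_2)$ is the unique maximum-weight component of $G\setminus(K_1\cup K_2)$ (weight $>\frac12$), $A(K_1,K_2)=V(G)\setminus(B(K_1,K_2)\cup K_1\cup K_2)$, $S(K_1,K_2)=(A(K_1,K_2),K_1\cup K_2,B(K_1,K_2))$. $S(K_1,K_2)$ is proper if some component $D$ of $G[A(K_1,K_2)]$ has $K_1\cup K_2\subseteq N(D)$, and, if $|K_1|=|K_2|=1$, $G[A(K_1,K_2)\cup K_1\cup K_2]$ is not a path between the vertices of $K_1$ and $K_2$. It is active if it is proper and for all cliques $K_1',K_2'$ with $S(K_1',K_2')$ proper and $K_1'\cup K_2'\ne K_1\cup K_2$: $B(K_1',K_2')\cup K_1'\cup K_2'$ is not a proper subset of $B(K_1,K_2)\cup K_1\cup K_2$, and if these two sets are equal then $B(K_1',K_2')\subseteq B(K_1,K_2)$. *)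

(* Defs.v *)
From mathcomp Require Import all_boot all_order all_algebra.
Set Implicit Arguments.
Unset Strict Implicit.
Unset Printing Implicit Defensive.
Import Order.TTheory GRing.Theory Num.Theory.
Local Open Scope ring_scope.

(* A finite simple graph is a symmetric irreflexive relation [e] on a finite
   type [T]; both properties are hypotheses of the theorem. *)
Section Graphs.
Variables (T : finType) (e : rel T).
Implicit Types (A B C D K S X : {set T}) (s c : seq T).

Definition clique K : Prop := {in K &, forall x y, x != y -> e x y}.

Definition closed_nbhd (v : T) : {set T} := [set u | (u == v) || e v u].

Definition nbhd_set D : {set T} :=
  [set v | (v \notin D) && [exists u in D, e u v]].

Definition component_of S (x : T) : {set T} :=
  [set y in S | connect [rel u v | [&& u \in S, v \in S & e u v]] x y].

(* The vertex sets of the connected components of the induced subgraph G[S]. *)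
Definition components S : {set {set T}} := [set component_of S x | x in S].

(* [s] lists, in order, the vertices of an induced path of G from [x] to [y];
   the length of the path is [(size s).-1]. *)
Definition induced_path s (x y : T) : Prop :=
  [/\ uniq s, ohead s = Some x, last x s = y &
      {in s &, forall u v,
         e u v = (index v s == (index u s).+1) || (index u s == (index v s).+1)}].

(* [c] lists, in cyclic order, the vertices of an induced cycle of length at
   least four. *)
Definition hole c : Prop :=
  [/\ uniq c, (4 <= size c)%N &
      {in c &, forall u v, e u v = (next c u == v) || (next c v == u)}].

Definition sparse : Prop :=
  forall c (v : T), hole c -> v \notin c ->
  exists a b : T, [/\ a \in c, b \in c, e a b &
    forall u, u \in c -> e v u -> u = a \/ u = b].

Definition triangle_free : Prop := ~ exists x y z : T, [/\ e x y, e y z & e x z].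

Definition induced_pyramid (a : T) (b : 'I_3 -> T) (P : 'I_3 -> seq T) : Prop :=
  [/\ forall i j, i != j -> e (b i) (b j),
      forall i, induced_path (P i) a (b i) /\ (1 <= (size (P i)).-1)%N,
      forall i j x, i != j -> x \in P i -> x \in P j -> x = a,
      forall i j x y, i != j -> x \in P i -> y \in P j -> x != a -> y != a ->
        e x y -> x = b i /\ y = b j
    & forall i j, (size (P i)).-1 = 1%N -> (size (P j)).-1 = 1%N -> i = j].

Definition induced_prism (a b : 'I_3 -> T) (P : 'I_3 -> seq T) : Prop :=
  [/\ forall i j, i != j -> e (a i) (a j) /\ e (b i) (b j),
      forall i j, a i != b j,
      forall i, induced_path (P i) (a i) (b i) /\ (1 <= (size (P i)).-1)%N,
      forall i j x, i != j -> x \in P i -> x \notin P j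
    & forall i j x y, i != j -> x \in P i -> y \in P j -> e x y ->
        (x = a i /\ y = a j) \/ (x = b i /\ y = b j)].

Definition class_F2 : Prop :=
  [/\ triangle_free, sparse,
      ~ exists a b P, induced_pyramid a b P
    & ~ exists a b P, induced_prism a b P].

(* The parts of the partition may be empty. *)
Definition separation A C B : Prop :=
  [/\ A :|: C :|: B = [set: T],
      [disjoint A & C], [disjoint A & B], [disjoint C & B]
    & forall x y, x \in A -> y \in B -> ~~ e x y].

Definition star_separation A C B : Prop :=
  separation A C B /\ exists2 v, v \in C & C \subset closed_nbhd v.

Definition star_cutset : Prop :=
  exists A C B, [/\ star_separation A C B, A != set0 & B != set0].

Variables (R : realFieldType) (w : T -> R).

Definition weight_function : Prop :=
  (forall x, 0 <= w x <= 1) /\ \sum_x w x = 1.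

Definition weight D : R := \sum_(x in D) w x.

Definition unbalanced (d : nat) : Prop :=
  ~ exists X, (#|X| <= d)%N /\
      forall D, D \in components (~: X) -> weight D <= 2^-1.

Variables K1 K2 : {set T}.

(* The maximum-weight component of G \ (K1 u K2); [heavy_componentP] below shows
   that it exists and is unique in an unbalanced pair. *)
Definition Bpart : {set T} :=
  odflt set0 [pick D in components (~: (K1 :|: K2)) |
    [forall D' in components (~: (K1 :|: K2)), weight D' <= weight D]].

Definition Apart : {set T} := ~: (Bpart :|: K1 :|: K2).

Definition proper_sep : Prop :=
  (exists2 D, D \in components Apart & K1 :|: K2 \subset nbhd_set D) /\
  (forall x y, K1 = [set x] -> K2 = [set y] ->
     ~ exists s, induced_path s x y /\ [set z in s] = Apart :|: K1 :|: K2).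

End Graphs.

Section Active.
Variables (T : finType) (e : rel T) (R : realFieldType) (w : T -> R).

Definition active_sep (K1 K2 : {set T}) : Prop :=
  proper_sep e w K1 K2 /\
  forall K1' K2' : {set T}, clique e K1' -> clique e K2' ->
    proper_sep e w K1' K2' -> K1' :|: K2' <> K1 :|: K2 ->
    let U := Bpart e w K1 K2 :|: K1 :|: K2 in
    let U' := Bpart e w K1' K2' :|: K1' :|: K2' in
    ~~ (U' \proper U) /\
    (U' = U -> Bpart e w K1' K2' \subset Bpart e w K1 K2).

Definition loosely_non_crossing (K1 K2 K1' K2' : {set T}) : Prop :=
  Apart e w K1 K2 :&: (K1' :|: K2') = set0 /\
  Apart e w K1' K2' :&: (K1 :|: K2) = set0.

End Active.

Section HeavyComponent.
Variables (T : finType) (e : rel T) (R : realFieldType) (w : T -> R).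
Hypotheses (e_sym : symmetric e) (w_weight : weight_function w).

Lemma components_trivI (S C D : {set T}) : C \in components e S ->
  D \in components e S -> C != D -> [disjoint C & D].
Proof.
move=> /imsetP[x xS ->] /imsetP[y yS ->]; apply: contraR => /pred0Pn[z /=].
rewrite !inE => /andP[/andP[_ xz] /andP[_ yz]].
set r := [rel _ _ | _] in xz yz.
have cs : connect_sym r.
  by apply: sym_connect_sym => u v /=; rewrite andbCA e_sym.
have xy : connect r x y by apply: connect_trans xz _; rewrite cs.
apply/eqP/setP=> u; rewrite !inE -/r; congr (_ && _).
exact: (same_connect cs xy).
Qed.

Lemma heavy_componentP (d : nat) (K1 K2 : {set T}) :
  unbalanced e w d -> (#|K1 :|: K2| <= d)%N ->
  let CC := components e (~: (K1 :|: K2)) in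
  let B := Bpart e w K1 K2 in
  [/\ B \in CC, 2^-1 < weight w B
    & {in CC, forall D, D != B -> weight w D < weight w B}].
Proof.
move=> unb cardK CC B; have [w01 w1] := w_weight.
have [D DC Dhalf] : exists2 D, D \in CC & 2^-1 < weight w D.
  apply/exists_inP; apply: contraT => /exists_inPn h; case: unb.
  by exists (K1 :|: K2); split=> // D /h; rewrite -leNgt.
have sub1 C C' : C \in CC -> C' \in CC -> C != C' ->
    weight w C + weight w C' <= 1.
  move=> Cc Cc' ne; have dis := components_trivI Cc Cc' ne.
  rewrite /weight -w1 -bigU //= [X in _ <= X](bigID [predU C & C']) /= lerDl.
  by apply: sumr_ge0 => x _; case/andP: (w01 x).
have light C : C \in CC -> C != D -> weight w C < 2^-1.
  move=> Cc ne; have := sub1 _ _ Cc DC ne.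
  rewrite -lerBrDr => /le_lt_trans; apply.
  by rewrite ltrBlDr -ltrBlDl; rewrite {1}[1](splitr 1) !mul1r addrK.
have -> : B = D.
  rewrite /B /Bpart -/CC; case: pickP => [C /andP[Cc /forall_inP h]|/(_ D)] /=.
    apply/eqP; apply: contraT => ne; have := h _ DC.
    by rewrite leNgt (lt_trans (light _ Cc ne) Dhalf).
  rewrite DC /= => /negP[]; apply/forall_inP => C Cc.
  by have [->//|ne] := eqVneq C D; rewrite ltW // (lt_trans (light _ Cc ne)).
by split=> // C Cc ne; apply: lt_trans (light _ Cc ne) Dhalf.
Qed.

End HeavyComponent.

(* Main.v *)
Require Import Defs.
From mathcomp Require Import all_boot all_order all_algebra zify.
Set Implicit Arguments.
Unset Strict Implicit.
Unset Printing Implicit Defensive.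
Import Order.TTheory GRing.Theory Num.Theory.

(* Write [K = K1 :|: K2], [A], [B] for the first separation and [L], [A'], [B']
   for the second. In a triangle-free sparse graph cliques have at most two
   vertices, and a vertex outside a hole has at most one neighbour in it.

   Minimality of [B :|: K] forces every vertex of [K] to have a neighbour in [B].
   Hence if [L] misses [B], then [B :|: K] lies inside [B' :|: L], and activity of
   the second separation makes the two sets equal or [K = L], so [L] misses [A].
   If [L] meets [A], it therefore meets [B] too, and the same argument together
   with the connectivity of the full components [D] of [A] and [E] of [A'] gives
   [x] in [K1 :&: E], [y] in [K2 :&: B'], [x'] in [L1 :&: D], [y'] in [L2 :&: B].
   If [K1] and [L1] share a vertex [p], then [p] has the two nonadjacent
   neighbours [x] and [x'] in a hole, against sparsity. Otherwise the heavy
   component of [G] minus [K :|: L] attaches only to [K2 :|: L2], so [K2] and [L2]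
   define a proper separation that contradicts the minimality of the first. *)

(** Only comparisons and equations between naturals are kept for [lia]; the graph facts in the
    context are cleared first. *)
Ltac nat_lia := repeat match goal with
  | H : is_true (_ <= _) |- _ => revert H
  | H : is_true (negb (@eq_op Datatypes_nat__canonical__eqtype_Equality _ _)) |- _ =>
      revert H
  | H : @eq ?N _ _ |- _ => unify N nat; revert H
  end; clear; lia.

(** * Connected sets and components of induced subgraphs *)

Section Connectivity.
Variables (T : finType) (e : rel T).
Hypothesis e_sym : symmetric e.
Implicit Types (S C D : {set T}).

Definition restr S : rel T := [rel u v | [&& u \in S, v \in S & e u v]].

Lemma restrE S u v : restr S u v = [&& u \in S, v \in S & e u v].
Proof. by []. Qed.

(** The empty set qualifies, so nonemptiness is stated separately where it matters. *)
Definition connected_set C := {in C &, forall u v, connect (restr C) u v}.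

Lemma restr_connect_sym S : connect_sym (restr S).
Proof. by apply: sym_connect_sym => u v; rewrite !restrE andbCA e_sym. Qed.

Lemma restr_connect_sub S S' x y :
  S \subset S' -> connect (restr S) x y -> connect (restr S') x y.
Proof.
move=> /subsetP sub; apply: connect_sub => u v /and3P[uS vS euv].
by apply: connect1; rewrite restrE !sub.
Qed.

(** The main use is to confine a connected set to one side of a separation, by passing membership in
    that side along edges. *)
Lemma connected_set_ind C (P : pred T) x : connected_set C -> x \in C -> P x ->
  (forall u v, u \in C -> v \in C -> e u v -> P u -> P v) ->
  forall y, y \in C -> P y.
Proof.
move=> cC xC Px step y yC; have /connectP[p pp ->] := cC x y xC yC.
elim: p x xC Px pp => [|z p IH] x xC Px //= /andP[/and3P[_ zC exz]].
exact/IH/(step x).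
Qed.

Lemma component_of_refl S x : x \in S -> x \in component_of e S x.
Proof. by move=> xS; rewrite inE xS connect0. Qed.

Lemma component_of_closed S x u v :
  u \in component_of e S x -> v \in S -> e u v -> v \in component_of e S x.
Proof.
rewrite !inE => /andP[uS xu] vS euv; rewrite vS /=.
by apply: connect_trans xu (connect1 _); rewrite /= uS vS.
Qed.

Lemma component_of_connected S x : connected_set (component_of e S x).
Proof.
set C := component_of e S x.
have reach u : u \in C -> connect (restr C) x u.
  rewrite inE => /andP[uS /connectP[p pp def_u]].
  have xC : x \in C.
    rewrite inE connect0 andbT; case: p pp def_u => [_ /= <-//|z p /=].
    by case/andP=> /and3P[].
  (* Peeling off the last vertex keeps the start [x] fixed; every prefix ends in [C], so each step
     of the walk is a step of [restr C], not merely of [restr S]. *)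
  elim/last_ind: p u pp def_u {uS} => [u _ ->|p z IH u] /=; first exact: connect0.
  rewrite rcons_path last_rcons => /andP[pp /and3P[lS zS elz]] ->.
  have lC : last x p \in C by rewrite inE lS; apply/connectP; exists p.
  apply: connect_trans (IH _ pp erefl) (connect1 _).
  by rewrite restrE lC elz (component_of_closed lC).
move=> u v /reach xu /reach xv; apply: connect_trans xv.
by rewrite restr_connect_sym.
Qed.

Lemma connected_sub_component S C x u : connected_set C -> C \subset S ->
  u \in C -> u \in component_of e S x -> C \subset component_of e S x.
Proof.
move=> cC /subsetP CS uC ux; apply/subsetP.
apply: (connected_set_ind cC uC ux) => v z vC /CS zS evz vx.
exact: component_of_closed evz.
Qed.

Lemma components_inv S D : D \in components e S ->
  [/\ D \subset S, connected_set D, (exists d, d \in D)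
    & forall u v, u \in D -> v \in S -> e u v -> v \in D].
Proof.
case/imsetP=> x xS ->; split.
- by apply/subsetP=> z; rewrite inE => /andP[].
- exact: component_of_connected.
- by exists x; apply: component_of_refl.
- by move=> u v; apply: component_of_closed.
Qed.

Lemma nbhd_setP D v :
  reflect (v \notin D /\ exists2 u, u \in D & e u v) (v \in nbhd_set e D).
Proof.
rewrite inE; apply: (iffP andP) => [[vD /exists_inP[u uD euv]]|[vD [u uD euv]]].
  by split=> //; exists u.
by split=> //; apply/exists_inP; exists u.
Qed.

End Connectivity.

(** * Induced paths and holes *)

Section Paths.
Variables (T : finType) (e : rel T).
Hypotheses (e_sym : symmetric e) (e_irr : irreflexive e).
Implicit Types (S C D : {set T}) (s c : seq T).

(** Positional form of [induced_path]: symmetry and irreflexivity settle the pairs not tested, and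
    adjacency becomes arithmetic on positions. *)
Definition chordless x0 s := forall i j, i < j -> j < size s ->
  e (nth x0 s i) (nth x0 s j) = (j == i.+1).

Lemma induced_path_chordless x0 s x y : induced_path e s x y -> chordless x0 s.
Proof.
case=> us _ _ ind i j ij js; have si := ltn_trans ij js.
rewrite ind ?mem_nth // !index_uniq //; nat_lia.
Qed.

Lemma chordless_induced_path x0 s : uniq s -> 0 < size s -> chordless x0 s ->
  induced_path e s (nth x0 s 0) (nth x0 s (size s).-1).
Proof.
case: s => //= x s us _ ch; split=> //; first by rewrite (last_nth x0).
move=> u v us' vs'; rewrite -{1}(nth_index x0 us') -{1}(nth_index x0 vs').
have hu : index u (x :: s) < size (x :: s) by rewrite index_mem.
have hv : index v (x :: s) < size (x :: s) by rewrite index_mem.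
set i := index u _ in hu *; set j := index v _ in hv *.
have [ij|ji|->] := ltngtP i j; last by rewrite e_irr; nat_lia.
- by rewrite ch //; nat_lia.
- by rewrite e_sym ch //; nat_lia.
Qed.

Lemma induced_path_rev s x y : induced_path e s x y -> induced_path e (rev s) y x.
Proof.
move=> ip; have ch := induced_path_chordless x ip.
case: ip => us hs ls _; have s0 : 0 < size s by case: s hs {us ls ch}.
have ey : nth x (rev s) 0 = y.
  by rewrite nth_rev // subn1 nth_last; case: s s0 ls {us hs ch}.
have ex : nth x (rev s) (size (rev s)).-1 = x.
  rewrite size_rev nth_rev ?prednK // subnn.
  by case: s hs {us ls ch s0 ey} => //= ? ? [->].
have := @chordless_induced_path x (rev s); rewrite ey ex; apply.
- by rewrite rev_uniq.
- by rewrite size_rev.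
move=> i j ij; rewrite size_rev => js.
by rewrite !nth_rev ?(ltn_trans ij js) // e_sym ch; nat_lia.
Qed.

(* The neighbours of [a] and [b] in [D] lie on opposite sides of the edge [ab]. *)
Lemma induced_path_no_cycle s x y D a b : induced_path e s x y ->
  connected_set e D -> {subset D <= s} -> a \in s -> b \in s -> e a b ->
  a \in nbhd_set e D -> b \in nbhd_set e D -> False.
Proof.
move=> [us _ _ ind] cD Ds.
wlog ab : a b / index b s = (index a s).+1.
  move=> W sa sb eab; have := eab; rewrite ind // => /orP[/eqP ab|/eqP ba].
    exact: (W a b).
  by move=> aD bD; apply: (W b a) => //; rewrite e_sym.
move=> sa sb eab /nbhd_setP[aD [u uD eua]] /nbhd_setP[bD [v vD evb]].
have ne z z' : z \in D -> z' \notin D -> z' \in s -> index z s != index z' s.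
  move=> zD z'D z's; apply: contraNneq z'D => /index_inj<- //; exact: Ds.
have hu : index u s < index a s.
  have := eua; rewrite ind // ?Ds //; have := ne _ _ uD bD sb; nat_lia.
have hv : index a s < index v s.
  have := evb; rewrite ind // ?Ds //; have := ne _ _ vD aD sa; nat_lia.
(* Edges of [D] join consecutive positions, so a walk in [D] from [u], before [a], to [v], beyond
   [b], would have to pass through [a], which is outside [D]. *)
have := connected_set_ind (P := fun z => index z s < index a s) cD uD hu.
move=> /(_ _ v vD) H; suff: index v s < index a s by nat_lia.
apply: H => w z wD zD; rewrite ind ?Ds //; have := ne _ _ zD aD sa; nat_lia.
Qed.

(* A shortest path has no chords. *)
Lemma connect_chordless S x y : connect (restr e S) x y -> x != y ->
  exists s, [/\ uniq (x :: rcons s y), chordless x (x :: rcons s y) & {subset s <= S}].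
Proof.
move=> cxy xy.
pose Q n := [exists t : n.-tuple T, path (restr e S) x t && (last x t == y)].
have exQ : exists n, Q n.
  case/connectP: cxy => p pp def_y; exists (size p).
  by apply/existsP; exists (in_tuple p); rewrite /= pp -def_y eqxx.
have [n /existsP[[t /= /eqP st] /andP[pt /eqP lt]] min] := ex_minnP exQ.
have Qof p : path (restr e S) x p -> last x p = y -> n <= size p.
  move=> pp lp; apply: min; apply/existsP; exists (in_tuple p).
  by rewrite /= pp lp eqxx.
(* Shortening the walk uses only vertices of [t], and by minimality the result is at least as long
   as [t]; so [t] had no repetition. *)
have ut : uniq (x :: t).
  have [p [pp lp up sub]] : exists p, [/\ path (restr e S) x p, last x p = y,
      uniq (x :: p) & {subset p <= t}].
    by move: lt; case: (shortenP pt) => p pp up sub lp; exists p.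
  apply: (leq_size_uniq up) => /=; last by rewrite ltnS st Qof.
  by move=> z; rewrite !inE => /orP[->//|/sub->]; rewrite orbT.
have sub : {subset t <= S}.
  elim: (t) (x) pt => [|z p IH] z0 //= /andP[/and3P[_ zS _] /IH sub] v.
  by rewrite inE => /predU1P[->|/sub].
have ch : chordless x (x :: t).
  move=> i j ij js; apply/idP/eqP=> [eij|ji]; last first.
    have it : i < size t by rewrite ji in js.
    by have /(pathP x)/(_ i it)/and3P[_ _] := pt; rewrite ji.
  apply/eqP; apply: contraT => ji.
  case: j => // j in ij js ji eij *; rewrite /= ltnS in js.
  have lasti : last x (take i t) = nth x (x :: t) i.
    rewrite (last_nth x) size_takel; last by nat_lia.
    by case: (i) ij => //= k kj; rewrite nth_take.
  have jS : nth x t j \in S by rewrite sub ?mem_nth.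
  have iS : nth x (x :: t) i \in S.
    case: (i) ij => [_|k kj] /=; last exact/sub/mem_nth/ltnW/(leq_trans kj).
    by case: (t) pt js => // z p /= /andP[/and3P[]].
  (* A chord from position [i] to position [j.+1] of [x :: t] bypasses what lies between. Positions
     in [t] are one lower, hence [take i] and [drop j]. *)
  have pd : path (restr e S) x (take i t ++ drop j t).
    have := pt; rewrite -{1}(cat_take_drop i t) cat_path => /andP[pi _].
    rewrite cat_path pi lasti /= (drop_nth x js) /= restrE iS jS [e _ _]eij /=.
    have := pt; rewrite -{1}(cat_take_drop j.+1 t) cat_path => /andP[_].
    rewrite (last_nth x) size_takel //=; congr path; rewrite nth_take //.
  have ld : last x (take i t ++ drop j t) = y.
    by rewrite -lt -[in RHS](cat_take_drop j t) !last_cat (drop_nth x js).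
  have := Qof _ pd ld; rewrite size_cat size_takel ?size_drop; nat_lia.
case/lastP: t => [|t z] in pt lt st ut sub ch *; first by rewrite -lt eqxx in xy.
rewrite last_rcons in lt; subst z; exists t; split=> // z zt.
by apply: sub; rewrite mem_rcons inE zt orbT.
Qed.

Lemma chordless_hole x0 c : uniq c -> 4 <= size c ->
  (forall i j, i < j -> j < size c -> e (nth x0 c i) (nth x0 c j) =
     (j == i.+1) || (i == 0) && (j == (size c).-1)) -> hole e c.
Proof.
move=> uc c4 ch; split=> // u v uc' vc'.
have nextE w z : w \in c -> z \in c -> (next c w == z) =
    (index z c == (index w c).+1) || (index z c == 0) && (index w c == (size c).-1).
  move=> wc zc; rewrite next_nth wc.
  case: c => // a c in uc c4 ch wc zc uc' vc' *.
  set s := a :: c; have hw : index w s < (size c).+1 by rewrite -index_mem in wc.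
  have hz : index z s < (size c).+1 by rewrite -index_mem in zc.
  rewrite -[nth a c _]/(nth a s (index w s).+1) -[size s]/(size c).+1.
  have inj := @index_inj _ a s; have [lw|gw] := ltnP (index w s) (size c).
    rewrite -(inj_in_eq inj) ?mem_nth // index_uniq //; nat_lia.
  have i0 : index a s = 0 by rewrite /= eqxx.
  (* For the last vertex the lookup in [next] runs past the end and returns its default [a], the
     head of the cycle: this is the closing edge. *)
  rewrite nth_default // -(inj_in_eq inj) ?mem_head // i0; nat_lia.
rewrite !nextE // -{1}(nth_index x0 uc') -{1}(nth_index x0 vc').
have hu : index u c < size c by rewrite index_mem.
have hv : index v c < size c by rewrite index_mem.
set i := index u _ in hu *; set j := index v _ in hv *.
have [ij|ji|->] := ltngtP i j; last by rewrite e_irr; nat_lia.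
- by rewrite ch //; nat_lia.
- by rewrite e_sym ch //; nat_lia.
Qed.

(** Shortest paths from [x] to [y] through [C1] and back through [C2] are chordless, and no edge
    joins their interiors. As [x] and [y] are nonadjacent, both interiors are nonempty, so the cycle
    has length at least four. *)
Lemma two_paths_hole (C1 C2 : {set T}) x y : ~~ e x y -> x != y ->
  connect (restr e (x |: (y |: C1))) x y -> connect (restr e (x |: (y |: C2))) x y ->
  [disjoint C1 & C2] -> {in C1 & C2, forall u v, ~~ e u v} ->
  exists c, [/\ hole e c, x \in c, y \in c &
    {subset c <= x |: (y |: (C1 :|: C2))}].
Proof.
move=> nxy xy con1; rewrite restr_connect_sym // => con2 dis anti.
have yx : y != x by rewrite eq_sym.
have [s1 [u1 ch1 S1]] := connect_chordless con1 xy.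
have [s2 [u2 ch2 S2]] := connect_chordless con2 yx.
move: u1 u2; rewrite !cons_uniq !rcons_uniq !mem_rcons !inE !negb_or.
case/and3P=> /andP[_ xs1] ys1 us1 /and3P[/andP[_ ys2] xs2] us2.
have s1C : {subset s1 <= C1}.
  move=> z zs; have := S1 _ zs; rewrite !inE.
  by case: eqP zs xs1 => [->->|_]//; case: eqP ys1 => [->|_]// /negP.
have s2C : {subset s2 <= C2}.
  move=> z zs; have := S2 _ zs; rewrite !inE.
  by case: eqP zs xs2 => [->->|_]//; case: eqP ys2 => [->|_]// /negP.
have ne s z z' : chordless z (z :: rcons s z') -> ~~ e z z' -> 0 < size s.
  by case: s => //= /(_ 0 1 isT isT) /= -> .
have s1n := ne _ _ _ ch1 nxy; have s2n : 0 < size s2.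
  by apply: ne ch2 _; rewrite e_sym.
exists ((x :: s1) ++ (y :: s2)); split; first 1 last.
- by rewrite mem_head.
- by rewrite mem_cat mem_head orbT.
- move=> z; rewrite mem_cat !inE.
  by case/orP=> /predU1P[->|z_s]; rewrite ?eqxx ?(s1C _ z_s) ?(s2C _ z_s) ?orbT.
apply: (@chordless_hole x).
- rewrite cat_uniq !cons_uniq xs1 us1 ys2 us2 /= inE.
  rewrite (negbTE yx) (negbTE ys1) /= andbT.
  apply/hasPn => z zs2; rewrite inE negb_or.
  have zC := s2C _ zs2; apply/andP; split.
    by apply: contraNneq xs2 => <-.
  by apply: contraTN zC => /s1C/(disjointFr dis)->.
- by rewrite size_cat /=; nat_lia.
move=> i j ij; rewrite !nth_cat size_cat.
rewrite -[size (x :: s1)]/(size s1).+1 -[size (y :: s2)]/(size s2).+1 => js.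
(* The cycle lists [x] and [y] once each, while each path lists both ends; [n1] and [n2] supply the
   missing end as the entry one past its half. *)
have n1 k : k <= (size s1).+1 -> nth x (x :: rcons s1 y) k =
    if k <= size s1 then nth x (x :: s1) k else y.
  case: k => //= k kl; rewrite nth_rcons ltnS in kl *.
  case: ltnP => // h; have -> : k = size s1 by nat_lia.
  by rewrite eqxx.
have n2 k : k <= (size s2).+1 -> nth y (y :: rcons s2 x) k =
    if k <= size s2 then nth x (y :: s2) k else x.
  case: k => //= k kl; rewrite nth_rcons ltnS in kl *.
  case: ltnP => h; first exact: set_nth_default.
  have -> : k = size s2 by nat_lia.
  by rewrite eqxx.
have h1 a b : a < b -> b <= (size s1).+1 ->
    e (nth x (x :: s1) a) (if b <= size s1 then nth x (x :: s1) b else y) = (b == a.+1).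
  move=> ab bs; have a1 : a <= size s1 by nat_lia.
  have := n1 a (leqW a1); rewrite a1 => <-; rewrite -n1 //.
  by apply: ch1; rewrite //= size_rcons.
have h2 a b : a < b -> b <= (size s2).+1 ->
    e (nth x (y :: s2) a) (if b <= size s2 then nth x (y :: s2) b else x) = (b == a.+1).
  move=> ab bs; have a2 : a <= size s2 by nat_lia.
  have := n2 a (leqW a2); rewrite a2 => <-; rewrite -n2 //.
  by apply: ch2; rewrite //= size_rcons.
have [is1|is1] := ltnP i (size s1).+1; have [js1|js1] := ltnP j (size s1).+1.
- have := h1 i j ij (ltnW js1); rewrite -ltnS js1 => ->; nat_lia.
(* Across the halves there are two edges: the one into [y], which ends the first path, and the
   closing one at [x], which ends the second. Interior pairs are nonadjacent by [anti]. *)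
- have [j1|j1] := eqVneq j (size s1).+1.
    have := h1 i j ij; rewrite j1 ltnn subnn => -> //; nat_lia.
  have [i0|i0] := posnP i.
    have := h2 (j - (size s1).+1) (size s2).+1; rewrite ltnn i0 e_sym => -> //; nat_lia.
  have /negbTE -> : ~~ e (nth x (x :: s1) i) (nth x (y :: s2) (j - (size s1).+1)).
    apply: anti.
      by case: (i) i0 is1 => // k _ h; apply/s1C/mem_nth.
    case E: (j - (size s1).+1) => [|k]; first by nat_lia.
    have ks2 : k < size s2 by nat_lia.
    exact/s2C/mem_nth.
  nat_lia.
- nat_lia.
have := h2 (i - (size s1).+1) (j - (size s1).+1).
have -> : j - (size s1).+1 <= size s2 by nat_lia.
move=> ->; nat_lia.
Qed.

End Paths.

(** * Heavy components and active separations *)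

Section Separations.
Variables (T : finType) (e : rel T) (R : realFieldType) (w : T -> R).
Hypotheses (e_sym : symmetric e) (e_irr : irreflexive e).
Hypotheses (triF : triangle_free e) (w_weight : weight_function w).
Hypothesis unb : unbalanced e w 8.
Implicit Types (K L C D : {set T}).

Local Notation B := (Bpart e w).
Local Notation A := (Apart e w).

Lemma clique_card_le2 K : clique e K -> #|K| <= 2.
Proof.
move=> cK; rewrite leqNgt; apply/negP => /card_gt2P[x [y [z [[xK yK zK] [xy yz zx]]]]].
by apply: triF; exists x, y, z; split; apply: cK => //; rewrite eq_sym.
Qed.

Lemma cliqueU_card_le4 K1 K2 : clique e K1 -> clique e K2 -> #|K1 :|: K2| <= 4.
Proof.
move=> /clique_card_le2 c1 /clique_card_le2 c2.
exact: leq_trans (leq_card_setU _ _) (leq_add c1 c2).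
Qed.

Lemma cliqueU_card_le8 K1 K2 : clique e K1 -> clique e K2 -> #|K1 :|: K2| <= 8.
Proof. by move=> cK1 cK2; apply: leq_trans (cliqueU_card_le4 cK1 cK2) _. Qed.

Lemma cliqueD1 K x : clique e K -> clique e (K :\ x).
Proof. by move=> cK u v; rewrite !inE => /andP[_ uK] /andP[_ vK]; apply: cK. Qed.

Lemma heavy_sets_meet C D : (2^-1 < weight w C)%R -> (2^-1 < weight w D)%R ->
  exists2 z, z \in C & z \in D.
Proof.
move=> hC hD; have [dis|] := boolP [disjoint C & D]; last first.
  by case/pred0Pn=> z /andP[zC zD]; exists z.
have [w01 w1] := w_weight.
have : (weight w C + weight w D <= 1)%R.
  rewrite /weight -w1 -bigU //= [X in (_ <= X)%R](bigID [predU C & D]) /= lerDl.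
  by apply: sumr_ge0 => x _; case/andP: (w01 x).
rewrite leNgt => /negP[]; rewrite [1%R](splitr 1) !mul1r; exact: ltrD.
Qed.

(** Bounding the union, rather than asking for cliques, lets this apply also to the pair
    [K1 :|: K2], [L1 :|: L2]. *)
Lemma Bpart_inv K1 K2 : #|K1 :|: K2| <= 8 ->
  [/\ connected_set e (B K1 K2), (2^-1 < weight w (B K1 K2))%R,
      forall v, v \in B K1 K2 -> v \notin K1 :|: K2
    & forall u v, u \in B K1 K2 -> e u v -> v \notin K1 :|: K2 -> v \in B K1 K2].
Proof.
move=> K8; have [BC hB _] := heavy_componentP e_sym w_weight unb K8.
have [/subsetP sub cB _ cl] := components_inv e_sym BC.
split=> // [v /sub|u v uB euv vK]; first by rewrite in_setC.
by apply: (cl u); rewrite ?in_setC.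
Qed.

Lemma heavy_sub_Bpart K1 K2 C : #|K1 :|: K2| <= 8 -> connected_set e C ->
  (2^-1 < weight w C)%R -> (forall v, v \in C -> v \notin K1 :|: K2) ->
  C \subset B K1 K2.
Proof.
move=> /Bpart_inv[_ hB _ cl] cC hC CK; apply/subsetP.
have [z zC zB] := heavy_sets_meet hC hB.
apply: (connected_set_ind cC zC zB) => u v uC vC euv uB.
exact: cl euv (CK v vC).
Qed.

(** Two heavy sets meet, and from a common vertex each of the two connected sets spreads inside the
    other. This recomputes the heavy component when the cutset changes. *)
Lemma heavy_eq_Bpart K1 K2 C : #|K1 :|: K2| <= 8 -> connected_set e C ->
  (2^-1 < weight w C)%R -> (forall v, v \in C -> v \notin K1 :|: K2) ->
  (forall u v, u \in C -> e u v -> v \notin K1 :|: K2 -> v \in C) -> B K1 K2 = C.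
Proof.
move=> K8 cC hC CK Ccl; apply/eqP; rewrite eqEsubset heavy_sub_Bpart // andbT.
have [cB hB BK _] := Bpart_inv K8; have [z zC zB] := heavy_sets_meet hC hB.
apply/subsetP; apply: (connected_set_ind cB zB zC) => u v uB vB euv uC.
exact: Ccl euv (BK v vB).
Qed.

Lemma in_Apart K1 K2 v :
  (v \in A K1 K2) = (v \notin B K1 K2) && (v \notin K1 :|: K2).
Proof. by rewrite !inE -orbA negb_or. Qed.

Lemma Bpart_sym K1 K2 : B K1 K2 = B K2 K1.
Proof. by rewrite /Bpart setUC. Qed.

Lemma Apart_sym K1 K2 : A K1 K2 = A K2 K1.
Proof. by rewrite /Apart Bpart_sym setUAC. Qed.

Lemma proper_sep_sym K1 K2 : proper_sep e w K1 K2 -> proper_sep e w K2 K1.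
Proof.
case=> [[D]]; rewrite Apart_sym setUC => DC KD np; split; first by exists D.
move=> x y Kx Ky [s [ip sE]]; apply: (np y x Ky Kx); exists (rev s); split.
  exact: induced_path_rev.
by rewrite setUAC -sE; apply/setP=> z; rewrite !inE mem_rev.
Qed.

Lemma active_sep_sym K1 K2 : active_sep e w K1 K2 -> active_sep e w K2 K1.
Proof.
case=> [pK act]; split; first exact: proper_sep_sym.
move=> L1 L2 cL1 cL2 pL; rewrite [K2 :|: K1]setUC => ne.
by have := act L1 L2 cL1 cL2 pL ne; rewrite [B K2 K1]Bpart_sym -!setUA [K2 :|: K1]setUC.
Qed.

Lemma proper_sep_component K1 K2 : proper_sep e w K1 K2 ->
  exists D, [/\ D \subset A K1 K2, connected_set e D, exists d, d \in D
    & forall v, v \in K1 :|: K2 -> v \in nbhd_set e D].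
Proof.
case=> [[D /(components_inv e_sym)[DA cD nD _] /subsetP KD] _].
by exists D; split.
Qed.

Lemma notin_Bpart_path K1 K2 (s : seq T) :
  [set z in s] = A K1 K2 :|: K1 :|: K2 -> forall z, z \notin B K1 K2 -> z \in s.
Proof.
move=> /setP sE z zB; have := sE z; rewrite inE => ->.
by rewrite -setUA inE in_Apart zB; case: (z \in _).
Qed.

(* Otherwise dropping [k] from [K1] and [K2] would give a smaller proper
   separation. *)
Lemma active_sep_attached K1 K2 k : clique e K1 -> clique e K2 ->
  active_sep e w K1 K2 -> k \in K1 :|: K2 -> exists2 b, b \in B K1 K2 & e b k.
Proof.
move=> cK1 cK2 [pK act] kK; apply/exists_inP; apply: contraT => /exists_inPn nBk.
have K8 : #|K1 :|: K2| <= 8 by exact: cliqueU_card_le8.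
have [cB hB BK Bcl] := Bpart_inv K8.
have cL1 := cliqueD1 (x := k) cK1; have cL2 := cliqueD1 (x := k) cK2.
have LE : (K1 :\ k) :|: (K2 :\ k) = (K1 :|: K2) :\ k by rewrite setDUl.
(* No vertex of the heavy component is adjacent to [k], so putting [k] back leaves that component
   unchanged. *)
have BL : B (K1 :\ k) (K2 :\ k) = B K1 K2.
  apply: heavy_eq_Bpart => // [|v /BK|u v uB euv].
  - exact: cliqueU_card_le8.
  - by rewrite LE; apply: contra => /setD1P[].
  rewrite LE; have [vk|vk] := eqVneq v k; last first.
    by rewrite in_setD1 vk; apply: Bcl euv.
  by rewrite vk (negPf (nBk u uB)) in euv.
have [D [/subsetP DA cD [d dD] KD]] := proper_sep_component pK.
have DB z : z \in D -> z \notin B K1 K2 by move/DA; rewrite in_Apart => /andP[].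
have pL : proper_sep e w (K1 :\ k) (K2 :\ k).
  have DL : D \subset A (K1 :\ k) (K2 :\ k).
    apply/subsetP=> z /DA; rewrite !in_Apart BL LE !inE negb_and negbK.
    by case/andP=> -> ->; rewrite orbT.
  split.
    have dL := subsetP DL d dD.
    exists (component_of e (A (K1 :\ k) (K2 :\ k)) d); first exact: imset_f.
    have /subsetP sub := connected_sub_component cD DL dD (component_of_refl e dL).
    apply/subsetP=> v; rewrite LE => /setD1P[vk vK].
    have /nbhd_setP[_ [u uD euv]] := KD v vK.
    apply/nbhd_setP; split; last by exists u => //; apply: sub.
    by rewrite inE in_Apart LE in_setD1 vk vK andbF.
  (* If both reduced cliques are singletons, [k] is adjacent to the remaining vertex [c] of a clique
     it belonged to. The alleged path would contain [D] and the edge from [c] to [k], both of whose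
     ends attach to [D]. *)
  move=> a b K1a K2b [s [ip sE]].
  have sP z : z \notin B K1 K2 -> z \in s.
    by rewrite -BL; apply: notin_Bpart_path.
  have [c [cK eck]] : exists c, c \in K1 :|: K2 /\ e c k.
    case/setUP: kK => kK.
      have /setD1P[ak aK] : a \in K1 :\ k by rewrite K1a set11.
      by exists a; rewrite inE aK cK1.
    have /setD1P[bk bK] : b \in K2 :\ k by rewrite K2b set11.
    by exists b; rewrite inE bK orbT cK2.
  have Ks z : z \in K1 :|: K2 -> z \in s by move=> zK; apply: sP; apply: contraL zK => /BK.
  apply: (induced_path_no_cycle e_sym ip cD _ (Ks _ cK) (Ks _ kK) eck); try exact: KD.
  by move=> z /DB; apply: sP.
have ne : (K1 :\ k) :|: (K2 :\ k) <> K1 :|: K2.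
  by rewrite LE => E; move: kK; rewrite -E !inE eqxx.
have [/negP[]] := act _ _ cL1 cL2 pL ne.
rewrite BL -!setUA LE; apply/properP; split; first exact/setUS/subD1set.
exists k; first by rewrite inE kK orbT.
by rewrite in_setU in_setD1 eqxx orbF; apply: contraL kK => /BK.
Qed.

Lemma Apart_Bpart_nadj K1 K2 u v : clique e K1 -> clique e K2 ->
  u \in A K1 K2 -> v \in B K1 K2 -> ~~ e u v.
Proof.
move=> cK1 cK2; rewrite in_Apart => /andP[uB uK] vB; apply: contra uB => euv.
have [_ _ _ cl] := Bpart_inv (cliqueU_card_le8 cK1 cK2).
by apply: cl vB _ uK; rewrite e_sym.
Qed.

Lemma Bpart_not_K K1 K2 v : clique e K1 -> clique e K2 ->
  v \in B K1 K2 -> v \notin K1 :|: K2.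
Proof.
move=> cK1 cK2.
by have [_ _ BK _] := Bpart_inv (cliqueU_card_le8 cK1 cK2); apply: BK.
Qed.

Lemma Apart_not_K K1 K2 v : v \in A K1 K2 -> v \notin K1 :|: K2.
Proof. by rewrite in_Apart => /andP[]. Qed.

Lemma partition3 K1 K2 v : [|| v \in A K1 K2, v \in B K1 K2 | v \in K1 :|: K2].
Proof. by rewrite in_Apart; case: (v \in B _ _); case: (v \in _ :|: _). Qed.

Lemma clique_meets_Apart K1 K2 L x v : clique e K1 -> clique e K2 -> clique e L ->
  x \in L -> x \in A K1 K2 -> v \in L -> v \notin B K1 K2.
Proof.
move=> cK1 cK2 cL xL xA vL; apply/negP=> vB.
have [xv|xv] := eqVneq x v; first by move: xA; rewrite in_Apart xv vB.
by have := Apart_Bpart_nadj cK1 cK2 xA vB; rewrite cL.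
Qed.

(** If [D] avoided [K1 :|: K2], it would stay on the side of [x], and [y] would have a neighbour
    across the separation. *)
Lemma nbhd_both_sides_meets K1 K2 D x y : clique e K1 -> clique e K2 ->
  connected_set e D -> x \in nbhd_set e D -> y \in nbhd_set e D ->
  x \in A K1 K2 -> y \in B K1 K2 -> exists2 z, z \in D & z \in K1 :|: K2.
Proof.
move=> cK1 cK2 cD /nbhd_setP[_ [u uD eux]] /nbhd_setP[_ [v vD evy]] xA yB.
apply/exists_inP; apply: contraT => /exists_inPn DK.
have nadj := Apart_Bpart_nadj cK1 cK2.
have side z t : z \in D -> t \in A K1 K2 -> e t z -> z \in A K1 K2.
  move=> zD tA etz; have /or3P[//|zB|zK] := partition3 K1 K2 z.
    by have := nadj _ _ tA zB; rewrite etz.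
  by rewrite (negPf (DK z zD)) in zK.
have uA : u \in A K1 K2 by apply: side xA _; rewrite // e_sym.
have vA : v \in A K1 K2.
  by apply: (connected_set_ind cD uD uA) => // s t _ tD est sA; apply: side est.
by have := nadj _ _ vA yB; rewrite evy.
Qed.

(** The set [B K1 K2] survives inside [B L1 L2], and each vertex of [K1 :|: K2] has a neighbour in
    it, hence is not in [A L1 L2]. Activity of the second pair then gives the first claim; the
    second claim serves when the pairs are exchanged. *)
Lemma active_sep_nested K1 K2 L1 L2 : clique e K1 -> clique e K2 ->
  clique e L1 -> clique e L2 -> active_sep e w K1 K2 -> active_sep e w L1 L2 ->
  (forall v, v \in L1 :|: L2 -> v \notin B K1 K2) ->
  (forall v, v \in L1 :|: L2 -> v \notin A K1 K2) /\
  (forall v, v \in K1 :|: K2 -> v \notin A L1 L2).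
Proof.
move=> cK1 cK2 cL1 cL2 aK aL LB.
have K8 : #|K1 :|: K2| <= 8 by exact: cliqueU_card_le8.
have L8 : #|L1 :|: L2| <= 8 by exact: cliqueU_card_le8.
have [cB hB BK _] := Bpart_inv K8.
have /subsetP BB : B K1 K2 \subset B L1 L2.
  by apply: heavy_sub_Bpart => // v; apply: contraL => /LB.
have KA v : v \in K1 :|: K2 -> v \notin A L1 L2.
  move=> vK; have [b bB ebv] := active_sep_attached cK1 cK2 aK vK.
  apply/negP=> vA; have := Apart_Bpart_nadj cL1 cL2 vA (BB b bB).
  by rewrite e_sym ebv.
split=> // v vL; have [KL|KL] := eqVneq (K1 :|: K2) (L1 :|: L2).
  by rewrite in_Apart KL vL andbF.
have [npr _] := aL.2 _ _ cK1 cK2 aK.1 (elimN eqP KL).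
have sub : B K1 K2 :|: K1 :|: K2 \subset B L1 L2 :|: L1 :|: L2.
  apply/subsetP=> z; rewrite -!setUA => /setUP[/BB zB|/KA]; first by rewrite inE zB.
  by rewrite in_Apart negb_and !negbK -in_setU.
move: npr; rewrite properE sub negbK => /subsetP/(_ v).
rewrite -!setUA in_setU vL orbT => /(_ isT); rewrite in_setU in_Apart.
by case/orP=> ->; rewrite ?andbF.
Qed.

(** A walk in [D] can enter [Q] only from [Q] itself or from [x'], so every vertex of [D] in [Q] is
    linked to [x'] without leaving [Q] before reaching [x']. *)
Lemma connect_in_side K1 K2 D (Q : {set T}) z x' : connected_set e D -> D \subset A K1 K2 ->
  x' \in D -> (forall u v, u \in D -> v \in Q -> e u v -> u \in Q \/ u = x') ->
  z \in D -> z \in Q -> connect (restr e (x' |: (A K1 K2 :&: Q))) z x'.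
Proof.
move=> cD /subsetP DA x'D QD zD zQ.
pose P u := (u \in Q) ==> connect (restr e (x' |: (A K1 K2 :&: Q))) u x'.
suff: P z by rewrite /P zQ.
apply: (connected_set_ind cD x'D) zD; first by rewrite /P connect0 implybT.
move=> u v uD vD euv /implyP Pu; apply/implyP => vQ.
have vS : v \in x' |: (A K1 K2 :&: Q) by rewrite !in_setU in_setI DA ?vQ ?orbT.
have [uQ|ux] := QD u v uD vQ euv.
  apply: connect_trans (Pu uQ); apply: connect1.
  by rewrite restrE vS e_sym euv !in_setU in_setI DA ?uQ ?orbT.
by apply: connect1; rewrite restrE vS -ux e_sym euv in_setU in_set1 eqxx.
Qed.

(** * The crossing configuration of two separations *)

Section Crossing.
Variables K1 K2 L1 L2 : {set T}.
Hypotheses (cK1 : clique e K1) (cK2 : clique e K2).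
Hypotheses (cL1 : clique e L1) (cL2 : clique e L2).
Hypothesis aK : active_sep e w K1 K2.
Variables (D E : {set T}) (x y x' y' : T).
Hypotheses (DA : D \subset A K1 K2) (cD : connected_set e D).
Hypothesis KD : forall v, v \in K1 :|: K2 -> v \in nbhd_set e D.
Hypotheses (EA : E \subset A L1 L2) (cE : connected_set e E).
Hypothesis LE : forall v, v \in L1 :|: L2 -> v \in nbhd_set e E.
Hypotheses (xK1 : x \in K1) (xE : x \in E) (yK2 : y \in K2) (yB : y \in B L1 L2).
Hypotheses (xL1 : x' \in L1) (xD : x' \in D) (yL2 : y' \in L2) (yB' : y' \in B K1 K2).

Let xA : x \in A L1 L2. Proof. exact: (subsetP EA). Qed.
Let xA' : x' \in A K1 K2. Proof. exact: (subsetP DA). Qed.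
Let xK : x \in K1 :|: K2. Proof. by rewrite inE xK1. Qed.
Let yK : y \in K1 :|: K2. Proof. by rewrite inE yK2 orbT. Qed.

(** No edge joins the two sides of a separation, so one vertex decides which side its clique misses:
    [x] for [K1], and in the next three lemmas [x'], [y] and [y'] for [L1], [K2] and [L2]. *)
Lemma crossing_K1 v : v \in K1 -> v \notin B L1 L2.
Proof. exact: clique_meets_Apart xK1 xA. Qed.

Lemma crossing_L1 v : v \in L1 -> v \notin B K1 K2.
Proof. exact: clique_meets_Apart xL1 xA'. Qed.

Lemma crossing_K2 v : v \in K2 -> v \notin A L1 L2.
Proof.
by move=> vK; apply/negP => vA; have := clique_meets_Apart cL1 cL2 cK2 vK vA yK2;
   rewrite yB.
Qed.

Lemma crossing_L2 v : v \in L2 -> v \notin A K1 K2.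
Proof.
by move=> vL; apply/negP => vA; have := clique_meets_Apart cK1 cK2 cL2 vL vA yL2;
   rewrite yB'.
Qed.

(* A common vertex [p] of [K1] and [L1] would have the two nonadjacent
   neighbours [x] and [x'] in a hole consisting of a path through
   [A K1 K2 :&: A L1 L2] and a path through the rest of the graph. *)
Lemma crossing_disjoint p : sparse e -> p \in K1 -> p \in L1 -> False.
Proof.
move=> sp pK1 pL1.
have pK : p \in K1 :|: K2 by rewrite inE pK1.
have pL : p \in L1 :|: L2 by rewrite inE pL1.
have px : p != x by apply: contraTneq pL => ->; apply: Apart_not_K.
have px' : p != x' by apply: contraTneq pK => ->; apply: Apart_not_K.
have epx : e p x by apply: cK1.
have epx' : e p x' by apply: cL1.
have nxx : ~~ e x x' by apply/negP => exx; apply: triF; exists p, x, x'.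
have xx : x != x' by apply: contraTneq xK => ->; apply: Apart_not_K.
(* A second vertex of [L1] in [A K1 K2] would form a triangle with [p] and [x']. *)
have LA v : v \in L1 :|: L2 -> v \in A K1 K2 -> v = x'.
  case/setUP=> vL vA; last by rewrite (negPf (crossing_L2 vL)) in vA.
  apply/eqP; apply: contraT => vx.
  have pv : p != v by apply: contraTneq pK => ->; apply: Apart_not_K.
  by case: triF; exists p, v, x'; split=> //; apply: cL1.
have nadjL := Apart_Bpart_nadj cL1 cL2; have nadjK := Apart_Bpart_nadj cK1 cK2.
(* Since [D] meets [L1 :|: L2] only in [x'], it passes between the sides of the second separation
   only there, as [connect_in_side] requires. *)
have sideA u v : u \in D -> v \in A L1 L2 -> e u v -> u \in A L1 L2 \/ u = x'.
  move=> uD vA euv; have /or3P[|uB|uL] := partition3 L1 L2 u; first by left.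
    by have := nadjL _ _ vA uB; rewrite e_sym euv.
  by right; apply: LA => //; apply: (subsetP DA).
have sideB u v : u \in D -> v \in B L1 L2 -> e u v -> u \in B L1 L2 \/ u = x'.
  move=> uD vB euv; have /or3P[uA||uL] := partition3 L1 L2 u; [|by left|].
    by have := nadjL _ _ uA vB; rewrite euv.
  by right; apply: LA => //; apply: (subsetP DA).
pose C1 := A K1 K2 :&: A L1 L2.
pose C2 := y |: (B K1 K2 :|: (A K1 K2 :&: B L1 L2)).
have con1 : connect (restr e (x |: (x' |: C1))) x x'.
  have /nbhd_setP[_ [c cD' ecx]] := KD xK.
  have [cA|cx] := sideA c x cD' xA ecx; last by rewrite -cx e_sym ecx in nxx.
  apply: (@connect_trans _ _ c); last first.
    apply: restr_connect_sub (connect_in_side cD DA xD sideA cD' cA).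
    exact: subsetUr.
  apply: connect1; rewrite restrE e_sym ecx !in_setU !in_set1 eqxx /= in_setI.
  by rewrite cA (subsetP DA) ?orbT.
(* The route goes from [x] through [B K1 K2] to [y], then through the part of [D] in [B L1 L2] to
   [x']. *)
have con2 : connect (restr e (x |: (x' |: C2))) x x'.
  have [b bB ebx] := active_sep_attached cK1 cK2 aK xK.
  have [b' bB' eby] := active_sep_attached cK1 cK2 aK yK.
  have [cB _ _ _] := Bpart_inv (cliqueU_card_le8 cK1 cK2).
  have inB z : z \in B K1 K2 -> z \in x |: (x' |: C2).
    by move=> zB; rewrite !in_setU zB ?orbT.
  have yC : y \in x |: (x' |: C2) by rewrite !in_setU !in_set1 eqxx ?orbT.
  apply: (@connect_trans _ _ b).
    by apply: connect1; rewrite restrE setU11 e_sym ebx inB.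
  apply: (@connect_trans _ _ b').
    by apply: restr_connect_sub (cB b b' bB bB'); apply/subsetP.
  apply: (@connect_trans _ _ y); first by apply: connect1; rewrite restrE yC eby inB.
  have /nbhd_setP[_ [c cD' ecy]] := KD yK.
  have [cB'|cx] := sideB c y cD' yB ecy; last first.
    by apply: connect1; rewrite restrE yC -cx e_sym ecy !in_setU !in_set1 eqxx orbT.
  apply: (@connect_trans _ _ c); last first.
    apply: restr_connect_sub (connect_in_side cD DA xD sideB cD' cB').
    by apply/subsetP=> z; rewrite !in_setU => /orP[->|->]; rewrite !orbT.
  apply: connect1; rewrite restrE yC e_sym ecy !in_setU in_setI cB' (subsetP DA) //.
  by rewrite !orbT.
have C1P z : z \in C1 -> z \in A K1 K2 /\ z \in A L1 L2 by case/setIP.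
have anti : {in C1 & C2, forall u v, ~~ e u v}.
  move=> u v /C1P[uA uA']; rewrite !in_setU in_set1 in_setI.
  case/or3P=> [/eqP->|vB|/andP[_ vB]]; [exact: nadjL|exact: nadjK|exact: nadjL].
have dis : [disjoint C1 & C2].
  apply/pred0P=> z /=; apply/negP=> /andP[/C1P[]].
  rewrite !in_Apart => /andP[zB _] /andP[zB' _].
  rewrite !in_setU in_set1 in_setI (negPf zB) (negPf zB') andbF !orbF => /eqP zy.
  by rewrite zy yB in zB'.
have [c [hc xc xc' cS]] := two_paths_hole e_sym e_irr nxx xx con1 con2 dis anti.
have pc : p \notin c.
  apply/negP=> /cS; rewrite !in_setU !in_set1 (negPf px) (negPf px') /= !in_setI.
  rewrite !in_Apart pK pL !andbF /=.
  have /negPf-> : p \notin B K1 K2 by apply: contraL pK; apply: Bpart_not_K.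
  have /negPf pB : p \notin B L1 L2 by apply: contraL pL; apply: Bpart_not_K.
  by rewrite !orbF => /eqP py; rewrite py yB in pB.
have [a [b [_ _ eab ab]]] := sp c p hc pc.
move: nxx xx; case: (ab x xc epx) (ab x' xc' epx') => -> [] ->; rewrite ?eqxx //.
- by rewrite eab.
- by rewrite e_sym eab.
Qed.




(* [A K1 K2 :|: K1 :|: K2] would be the segment of [s] from [y] to [x]. *)
Lemma crossing_not_path s : (forall z, z \notin B K1 K2 :&: B L1 L2 -> z \in s) ->
  K2 = [set y] -> L2 = [set y'] -> induced_path e s y y' -> False.
Proof.
move=> sP K2y L2y ip.
have DB z : z \in D -> z \notin B K1 K2.
  by move/(subsetP DA); rewrite in_Apart => /andP[].
have KB z : z \in K1 :|: K2 -> z \notin B K1 K2.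
  by apply: contraL => /(Bpart_not_K cK1 cK2).
have BP z : z \notin B K1 K2 -> z \in s.
  by move=> zB; apply: sP; rewrite in_setI (negPf zB).
(* A second vertex of [K1] would give an edge of the path with both ends attached to [D], which lies
   on the path. *)
have K1x : K1 = [set x].
  apply/setP=> v; rewrite in_set1; apply/idP/eqP => [vK|->//].
  apply/eqP; apply: contraT => vx.
  have vKK : v \in K1 :|: K2 by rewrite inE vK.
  case: (induced_path_no_cycle (a := x) (b := v) e_sym ip cD).
  - by move=> z /DB/BP.
  - exact/BP/KB.
  - exact/BP/KB.
  - by apply: cK1; rewrite // eq_sym.
  - exact: KD.
  - exact: KD.
have Kxy z : z \in K1 :|: K2 -> z = x \/ z = y.
  by rewrite K1x K2y !inE => /orP[]/eqP; [left|right].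
have ch := induced_path_chordless y ip.
have [us hs ls ind] := ip.
have s0 : 0 < size s by case: (s) hs.
have n0 : nth y s 0 = y by case: (s) hs => //= ? ? [].
have nl : nth y s (size s).-1 = y' by rewrite nth_last; case: (s) ls s0.
have ys : y \in s by apply/BP/KB.
have xs : x \in s by apply/BP/KB.
have iy : index y s = 0 by rewrite -{1}n0 index_uniq.
set i := index x s; have iS : i < size s by rewrite index_mem.
have ni : nth y s i = x by rewrite nth_index.
have notK j : j < size s -> j != 0 -> j != i -> nth y s j \notin K1 :|: K2.
  move=> js j0 ji; apply/negP=> /Kxy[] nj.
    by move: ji; rewrite /i -nj index_uniq ?eqxx.
  by move: j0; rewrite -[j in j != 0](index_uniq y js us) nj iy.
have nadj := Apart_Bpart_nadj cK1 cK2.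
(* Here [m] counts back from the last vertex [y'], which is in [B K1 K2]. Beyond [x] the path avoids
   [K1 :|: K2], so it never leaves [B K1 K2]. *)
have up m : i < (size s).-1 - m -> nth y s ((size s).-1 - m) \in B K1 K2.
  elim: m => [|m IH] im; first by rewrite subn0 nl.
  have im' : i < (size s).-1 - m by nat_lia.
  have js : (size s).-1 - m.+1 < size s by nat_lia.
  have /or3P[jA|//|jK] := partition3 K1 K2 (nth y s ((size s).-1 - m.+1)).
    have jS : (size s).-1 - m == ((size s).-1 - m.+1).+1 by nat_lia.
    have lt1 : (size s).-1 - m.+1 < (size s).-1 - m by nat_lia.
    have lt2 : (size s).-1 - m < size s by nat_lia.
    by have := nadj _ _ jA (IH im'); rewrite ch ?jS.
  have j0 : (size s).-1 - m.+1 != 0 by nat_lia.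
  have ji : (size s).-1 - m.+1 != i by nat_lia.
  by have := notK _ js j0 ji; rewrite jK.
(* Position 1 is the neighbour of [y] in [D]; from there the path stays in [A K1 K2] until it
   reaches [x], the only other cutset vertex. *)
have down j : j.+1 < i -> nth y s j.+1 \in A K1 K2.
  elim: j => [|j IH] ji.
    have /nbhd_setP[_ [u uD euy]] := KD yK.
    have us' : u \in s by apply/BP/DB.
    have /orP[//|/eqP iu] : (0 == (index u s).+1) || (index u s == 1).
      by rewrite -iy -ind.
    by rewrite -iu nth_index //; apply: (subsetP DA).
  have jA := IH (ltnW ji); have js : j.+2 < size s by nat_lia.
  have /or3P[//|jB|jK] := partition3 K1 K2 (nth y s j.+2).
    by have := nadj _ _ jA jB; rewrite ch ?eqxx.
  have ne : j.+2 != i by nat_lia.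
  by have := notK _ js isT ne; rewrite jK.
pose t := take i.+1 s.
have st : size t = i.+1 by rewrite size_takel.
have ipt : induced_path e t y x.
  have := @chordless_induced_path _ _ e_sym e_irr y t.
  rewrite st /= {1 2}/t !nth_take // n0 ni; apply.
  - exact: take_uniq.
  - by [].
  move=> a b ab; rewrite st => bi; rewrite !nth_take //; last by nat_lia.
  have bs : b < size s by nat_lia.
  exact: ch.
case: aK => [[_ np] _]; apply: (np x y K1x K2y).
exists (rev t); split; first exact: induced_path_rev.
apply/setP=> z; rewrite inE mem_rev -setUA in_setU.
apply/idP/idP => [zt|zAK].
  have zs : z \in s by apply: mem_take zt.
  have zi : index z s <= i by move: zt; rewrite in_take.
  have [z0|z0] := posnP (index z s).
    by rewrite -(nth_index y zs) z0 n0 yK orbT.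
  have [zi'|zi'] := eqVneq (index z s) i.
    by rewrite -(nth_index y zs) zi' ni xK orbT.
  have := down (index z s).-1; rewrite prednK // nth_index // => -> //.
  nat_lia.
have zs : z \in s.
  by case/orP: zAK => [|/KB/BP//]; rewrite in_Apart => /andP[/BP].
rewrite in_take // ltnS leqNgt; apply/negP=> iz.
have zS : index z s < size s by rewrite index_mem.
have := up ((size s).-1 - index z s).
rewrite subKn ?nth_index //; last by nat_lia.
move=> /(_ iz) zB; case/orP: zAK => [|/KB]; last by rewrite zB.
by rewrite in_Apart zB.
Qed.

Lemma crossing_absurd : (forall p, p \in K1 -> p \in L1 -> False) -> False.
Proof.
move=> noP.
(* Four cliques of at most two vertices each: this is where the bound 8 comes from. *)
have M8 : #|(K1 :|: K2) :|: (L1 :|: L2)| <= 8.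
  apply: leq_trans (leq_card_setU _ _) _.
  exact: (leq_add (cliqueU_card_le4 cK1 cK2) (cliqueU_card_le4 cL1 cL2)).
have [cB0 hB0 B0M B0cl] := Bpart_inv M8.
set B0 := B (K1 :|: K2) (L1 :|: L2) in cB0 hB0 B0M B0cl.
have B0K : B0 \subset B K1 K2.
  apply: heavy_sub_Bpart => // [|v /B0M]; first exact: cliqueU_card_le8.
  by rewrite inE negb_or => /andP[].
have B0L : B0 \subset B L1 L2.
  apply: heavy_sub_Bpart => // [|v /B0M]; first exact: cliqueU_card_le8.
  by rewrite inE negb_or => /andP[].
have nadjK := Apart_Bpart_nadj cK1 cK2; have nadjL := Apart_Bpart_nadj cL1 cL2.
(* A vertex of [K1] outside [K2 :|: L2] and attached to [B0] is on neither side of the second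
   separation, so it would lie in [L1], against [noP]. The same holds for [L1], so [B0] attaches
   only to [K2 :|: L2]. *)
have BM : B K2 L2 = B0.
  apply: heavy_eq_Bpart => // [|v /B0M|u v uB euv].
  - exact: cliqueU_card_le8.
  - by rewrite !inE !negb_or => /andP[/andP[_ ->] /andP[_ ->]].
  rewrite inE negb_or => /andP[vK2 vL2].
  have vA : v \notin A K1 K2.
    by apply/negP=> vA; have := nadjK _ _ vA (subsetP B0K u uB); rewrite e_sym euv.
  have vA' : v \notin A L1 L2.
    by apply/negP=> vA'; have := nadjL _ _ vA' (subsetP B0L u uB); rewrite e_sym euv.
  apply: B0cl euv _ => //; rewrite !inE !negb_or vK2 vL2 !andbT.
  apply/andP; split; apply/negP=> v1.
    have := partition3 L1 L2 v; rewrite (negPf vA') (negPf (crossing_K1 v1)) inE.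
    by rewrite (negPf vL2) orbF => /(noP v v1).
  have := partition3 K1 K2 v; rewrite (negPf vA) (negPf (crossing_L1 v1)) inE.
  by rewrite (negPf vK2) orbF => vK1; apply: (noP v).
have AM z : z \notin B0 -> z \notin K2 -> z \notin L2 -> z \in A K2 L2.
  by move=> zB zK zL; rewrite in_Apart BM zB inE negb_or zK.
have DM : D \subset A K2 L2.
  apply/subsetP=> z /(subsetP DA) zA; apply: AM.
  - by apply: contraTN zA => /(subsetP B0K) zB; rewrite in_Apart zB.
  - by apply: contraTN zA => zK; rewrite in_Apart !inE zK orbT andbF.
  - by apply: contraTN zA; apply: crossing_L2.
have EM : E \subset A K2 L2.
  apply/subsetP=> z /(subsetP EA) zA; apply: AM.
  - by apply: contraTN zA => /(subsetP B0L) zB; rewrite in_Apart zB.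
  - by apply: contraTN zA; apply: crossing_K2.
  - by apply: contraTN zA => zL; rewrite in_Apart !inE zL orbT andbF.
have pM : proper_sep e w K2 L2.
  split.
    (* Since [x] lies in [E] and has a neighbour in [D], one component contains both sets; [K2]
       attaches to it through [D], and [L2] through [E]. *)
    pose C := component_of e (A K2 L2) x'.
    have xM' : x' \in A K2 L2 by apply: (subsetP DM).
    have xC' : x' \in C by apply: component_of_refl.
    exists C; first exact: imset_f.
    have DC := subsetP (connected_sub_component cD DM xD xC').
    have xC : x \in C.
      have /nbhd_setP[_ [u uD eux]] := KD xK.
      by apply: component_of_closed (DC u uD) _ eux; apply: (subsetP EM).
    have EC := subsetP (connected_sub_component cE EM xE xC).
    apply/subsetP=> v vM; apply/nbhd_setP; split.
      by rewrite inE in_Apart vM andbF.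
    case/setUP: vM => [vK|vL].
      have /nbhd_setP[_ [u /DC uC euv]] : v \in nbhd_set e D.
        by apply: KD; rewrite inE vK orbT.
      by exists u.
    have /nbhd_setP[_ [u /EC uC euv]] : v \in nbhd_set e E.
      by apply: LE; rewrite inE vL orbT.
    by exists u.
  move=> y0 y0' K2y L2y [s [ip sE]].
  have yy : y = y0 by apply/set1P; rewrite -K2y.
  have yy' : y' = y0' by apply/set1P; rewrite -L2y.
  subst y0 y0'; apply: (@crossing_not_path s) => // z zB.
  apply: (notin_Bpart_path sE); rewrite BM; apply: contra zB => zB0.
  by rewrite in_setI (subsetP B0K) ?(subsetP B0L).
have xnot : x \notin K2 :|: L2.
  rewrite inE negb_or; apply/andP; split.
    by apply/negP=> /crossing_K2; rewrite xA.
  by have := Apart_not_K xA; rewrite inE negb_or => /andP[].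
have ne : K2 :|: L2 <> K1 :|: K2 by move=> eqM; rewrite eqM xK in xnot.
(* The inclusion holds because [L2] misses [A K1 K2]; it is proper because the smaller set misses
   [x]. *)
have [/negP[]] := aK.2 _ _ cK2 cL2 pM ne.
rewrite BM -!setUA; apply/properP; split.
  apply/subsetP=> z /setUP[/(subsetP B0K) zB|/setUP[zK|zL]].
  - by rewrite inE zB.
  - by rewrite !inE zK !orbT.
  have := partition3 K1 K2 z; rewrite (negPf (crossing_L2 zL)) /=.
  by rewrite -in_setU.
exists x; first by rewrite inE xK orbT.
rewrite in_setU negb_or xnot andbT; apply: contraL xK => /(subsetP B0K).
exact: Bpart_not_K.
Qed.

End Crossing.

(** This is one half of loose non-crossing; exchanging the pairs gives the other. A vertex of
    [L1 :|: L2] in [A K1 K2] yields all the witnesses of the crossing configuration. *)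
Lemma active_sep_loose K1 K2 L1 L2 : sparse e -> clique e K1 -> clique e K2 ->
  clique e L1 -> clique e L2 -> active_sep e w K1 K2 -> active_sep e w L1 L2 ->
  A K1 K2 :&: (L1 :|: L2) = set0.
Proof.
move=> sp cK1 cK2 cL1 cL2 aK aL.
apply/eqP; apply: contraT => /set0Pn[v /setIP[vA vL]]; exfalso.
have [u uL uB] : exists2 u, u \in L1 :|: L2 & u \in B K1 K2.
  apply/exists_inP; apply: contraT => /exists_inPn LB.
  have [LA _] := active_sep_nested cK1 cK2 cL1 cL2 aK aL LB.
  by have := LA v vL; rewrite vA.
have [y yK yB] : exists2 y, y \in K1 :|: K2 & y \in B L1 L2.
  apply/exists_inP; apply: contraT => /exists_inPn KB.
  have [_ LA] := active_sep_nested cL1 cL2 cK1 cK2 aL aK KB.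
  by have := LA v vL; rewrite vA.
have [D [DA cD _ KD]] := proper_sep_component aK.1.
have [E [EA cE _ LE]] := proper_sep_component aL.1.
(* [E] attaches to [v] and [u], on opposite sides of the first separation, so it meets [K1 :|: K2].
   Then [x] and [y] play the same part for [D] and the second separation. *)
have [x xE xK] := nbhd_both_sides_meets cK1 cK2 cE (LE v vL) (LE u uL) vA uB.
have xA := subsetP EA x xE.
have [x' xD' xL'] := nbhd_both_sides_meets cL1 cL2 cD (KD x xK) (KD y yK) xA yB.
have xA' := subsetP DA x' xD'.
wlog xK1 : K1 K2 cK1 cK2 aK vA uB yK DA KD xK xA' / x \in K1.
  move=> W; have := xK; case/setUP => xK'; first exact: (W K1 K2).
  apply: (W K2 K1) => //; rewrite 1?[K2 :|: K1]setUC 1?Apart_sym 1?Bpart_sym //.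
  - exact: active_sep_sym.
wlog xL1 : L1 L2 cL1 cL2 aL vL uL yB EA LE xL' xA / x' \in L1.
  move=> W; have := xL'; case/setUP => xL''; first exact: (W L1 L2).
  apply: (W L2 L1) => //; rewrite 1?[L2 :|: L1]setUC 1?Apart_sym 1?Bpart_sym //.
  - exact: active_sep_sym.
have yK2 : y \in K2.
  case/setUP: yK => // yK1.
  by have := clique_meets_Apart cL1 cL2 cK1 xK1 xA yK1; rewrite yB.
have uL2 : u \in L2.
  case/setUP: uL => // uL1.
  by have := clique_meets_Apart cK1 cK2 cL1 xL1 xA' uL1; rewrite uB.
apply: (crossing_absurd cK1 cK2 cL1 cL2 aK DA cD KD EA cE LE xK1 xE yK2 yB xL1 xD' uL2 uB).
move=> p.
exact: (crossing_disjoint cK1 cK2 cL1 cL2 aK DA cD KD EA xK1 xE yK2 yB xL1 xD' uL2 uB sp).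
Qed.

End Separations.

Theorem theorem5p1 (T : finType) (e : rel T) (R : realFieldType) (w : T -> R)
    (e_sym : symmetric e) (e_irr : irreflexive e)
    (GF2 : class_F2 e)
    (w_weight : weight_function w)
    (Gw_unb : unbalanced e w 8)
    (no_star : ~ star_cutset e)
    (K1 K2 K1' K2' : {set T})
    (cK1 : clique e K1) (cK2 : clique e K2)
    (cK1' : clique e K1') (cK2' : clique e K2')
    (act : active_sep e w K1 K2) (act' : active_sep e w K1' K2') :
  loosely_non_crossing e w K1 K2 K1' K2'.
Proof.
by have [triF sp _ _] := GF2; split; apply: active_sep_loose.
Qed.
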